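(* Let $\mathbb{F}=\mathbb{R}$ or $\mathbb{C}$, $n\geqslant2$, and let $\lambda_1,\ldots,\lambda_{n-1}\in\mathbb{F}$ be non-zero. Let $\mathfrak{g}$ be the $n$-dimensional Lie algebra over $\mathbb{F}$ with basis $e_1,\ldots,e_n$ and non-zero commutation relations $[e_k,e_n]=\lambda_ke_k$, $k=1,\ldots,n-1$. Then a complete set of generalized Casimir operators (i.e. a basis of $\mathrm{Inv}(\mathfrak{g})$) is formed by \[ e_1^{-\lambda_j}e_j^{\lambda_1},\qquad j=2,\ldots,n-1. \]
   Context: For a finite-dimensional Lie algebra $\mathfrak{g}$ with basis $e_1,\ldots,e_n$, $[e_i,e_j]=c_{ij}^ke_k$, let $x_1,\ldots,x_n$ be the coordinates on $\mathfrak{g}^*$ associated with the dual basis. An invariant of the coadjoint action is a (possibly only locally defined, on a connected open set) smooth (analytic if $\mathbb{F}=\mathbb{C}$) function $F(x_1,\ldots,x_n)$ invariant under the coadjoint action, equivalently $\sum_{j,k}c_{ij}^kx_k\,\partial F/\partial x_j=0$ for all $i$. The maximal number of functionally independent invariants is $N_\mathfrak{g}=\dim\mathfrak{g}-\sup_x\operatorname{rank}(\sum_k c_{ij}^kx_k)_{i,j}$. A basis of invariants is a set of $N_\mathfrak{g}$ functionally independent invariants (every invariant is then locally a function of them). Elements of $\mathrm{Inv}(\mathfrak{g})$ (generalized Casimir operators) are obtained from invariants by replacing $x_i$ by $e_i$ (with symmetrization of non-commuting products); here only the mutually commuting elements $e_1,\ldots,e_{n-1}$ occur, so $e_i$ may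 simply be read as the coordinate $x_i$. Powers with non-integer exponents are understood as local branches (on the domain where all $x_i>0$, say, if $\mathbb{F}=\mathbb{R}$). *)

(* Defs.v *)
From HB Require Import structures.
From mathcomp Require Import all_boot all_order all_algebra.
From mathcomp Require Import all_classical all_reals all_analysis.
From mathcomp Require Export complex.

Set Implicit Arguments.
Unset Strict Implicit.
Unset Printing Implicit Defensive.

Import Order.TTheory GRing.Theory Num.Theory.
Import numFieldNormedType.Exports.

Local Open Scope classical_set_scope.
Local Open Scope ring_scope.

Definition is_lie_bracket (K : fieldType) (g : vectType K) (br : g -> g -> g)
    : Prop :=
  [/\ forall (a : K) (u v w : g), br (a *: u + v) w = a *: br u w + br v w,
      forall (a : K) (u v w : g), br w (a *: u + v) = a *: br w u + br w v,
      forall u : g, br u u = 0 &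
      forall u v w : g, br u (br v w) + br v (br w u) + br w (br u v) = 0].

(* c_ij^k, i.e. [e_i, e_j] = \sum_k c_ij^k e_k when e is a basis. *)
Definition structure_constant (K : fieldType) (g : vectType K)
    (br : g -> g -> g) (n : nat) (e : n.-tuple g) (i j k : 'I_n) : K :=
  coord e k (br (tnth e i) (tnth e j)).

(* A point of the dual space is the row vector x of its coordinates with
   respect to the basis dual to e: x 0 k is its value on e_k. *)
Definition coadjoint_matrix (K : fieldType) (g : vectType K)
    (br : g -> g -> g) (n : nat) (e : n.-tuple g) (x : 'rV[K]_n) : 'M[K]_n :=
  \matrix_(i, j) \sum_k structure_constant br e i j k * x 0 k.

(* N_g = dim g - sup_x rank (\sum_k c_ij^k x_k)_ij. The ranks are at most n, so
   the supremum is the maximum of the finitely many values attained. *)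
Definition number_of_invariants (K : fieldType) (g : vectType K)
    (br : g -> g -> g) (n : nat) (e : n.-tuple g) : nat :=
  (\dim {: g} - \max_(r < n.+1 |
     `[< exists x : 'rV[K]_n, \rank (coadjoint_matrix br e x) = r >]) r)%N.

Definition partial (K : numFieldType) (n : nat) (j : 'I_n)
    (F : 'rV[K]_n -> K) : 'rV[K]_n -> K :=
  fun x => 'D_(delta_mx 0 j) F x.

Definition continuous_on (K : numFieldType) (n : nat) (U : set 'rV[K]_n)
    (F : 'rV[K]_n -> K) : Prop :=
  forall x, U x -> {for x, continuous F}.

Fixpoint Ck_on (K : numFieldType) (n : nat) (k : nat) (U : set 'rV[K]_n)
    (F : 'rV[K]_n -> K) : Prop :=
  match k with
  | 0%N => continuous_on U F
  | k'.+1 => (forall x, U x -> differentiable F x) /\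
             forall j : 'I_n, Ck_on k' U (partial j F)
  end.

(* Differentiability is over K: for the real field this is C^oo, and for the
   complex field it is complex differentiability, i.e. analyticity. Only the
   values of F on the open set U matter. *)
Definition smooth_on (K : numFieldType) (n : nat) (U : set 'rV[K]_n)
    (F : 'rV[K]_n -> K) : Prop :=
  forall k : nat, Ck_on k U F.

Definition domain (K : numFieldType) (n : nat) (U : set 'rV[K]_n) : Prop :=
  [/\ open U, connected U & U !=set0].

(* Local invariants of the coadjoint action, defined on U. *)
Definition is_invariant (K : numFieldType) (g : vectType K)
    (br : g -> g -> g) (n : nat) (e : n.-tuple g) (U : set 'rV[K]_n)
    (F : 'rV[K]_n -> K) : Prop :=
  smooth_on U F /\
  forall x, U x -> forall i : 'I_n,
    \sum_j \sum_k structure_constant br e i j k * x 0 k * partial j F x = 0.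

(* On no nonempty open V in U do the F_j satisfy a relation
   Phi (F_1, ..., F_m) = 0 where Phi is smooth near the values taken on V and
   vanishes identically on no nonempty open set. *)
Definition functionally_independent (K : numFieldType) (n m : nat)
    (U : set 'rV[K]_n) (F : 'I_m -> 'rV[K]_n -> K) : Prop :=
  forall V : set 'rV[K]_n, open V -> V !=set0 -> V `<=` U ->
  forall (W : set 'rV[K]_m) (Phi : 'rV[K]_m -> K),
    open W -> smooth_on W Phi ->
    (forall x, V x -> W (\row_j F j x) /\ Phi (\row_j F j x) = 0) ->
    exists W' : set 'rV[K]_m,
      [/\ open W', W' !=set0, W' `<=` W & forall z, W' z -> Phi z = 0].

Definition basis_of_invariants (K : numFieldType) (g : vectType K)
    (br : g -> g -> g) (n : nat) (e : n.-tuple g) (U : set 'rV[K]_n)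
    (m : nat) (F : 'I_m -> 'rV[K]_n -> K) : Prop :=
  [/\ forall j, is_invariant br e U (F j),
      functionally_independent U F &
      m = number_of_invariants br e].

(* The dimension n >= 2 is written m.+2. The indices 1, ..., n-1 of the
   commuting basis elements are the ordinals ab_idx k with k : 'I_m.+1, and
   e_n has index ord_max. *)
Definition ab_idx (m : nat) (k : 'I_m.+1) : 'I_m.+2 :=
  widen_ord (leqnSn m.+1) k.

Definition diagonal_relations (K : fieldType) (g : vectType K)
    (br : g -> g -> g) (m : nat) (e : m.+2.-tuple g) (lambda : 'I_m.+1 -> K)
    : Prop :=
  (forall k, br (tnth e (ab_idx k)) (tnth e ord_max) =
             lambda k *: tnth e (ab_idx k)) /\
  (forall k l, br (tnth e (ab_idx k)) (tnth e (ab_idx l)) = 0).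

Definition expC (R : realType) (z : R[i]) : R[i] :=
  Complex (expR (complex.Re z) * cos (complex.Im z))
          (expR (complex.Re z) * sin (complex.Im z)).

(* p is a branch on U of x |-> x_i ^ a, namely exp (a l) for a continuous
   branch l on U of log x_i; in particular x_i does not vanish on U. *)
Definition power_branch (R : realType) (n : nat) (U : set 'rV[R[i]]_n)
    (i : 'I_n) (a : R[i]) (p : 'rV[R[i]]_n -> R[i]) : Prop :=
  exists2 l : 'rV[R[i]]_n -> R[i], continuous_on U l &
    forall x, U x -> expC (l x) = x 0 i /\ p x = expC (a * l x).

(* Main.v *)
(* Write x_1, ..., x_n for the coordinates. A branch p of x_i ^ a has
   logarithmic derivative dp / p = a dx_i / x_i. Hence
   F_j = x_1 ^ (- lambda_j) * x_j ^ lambda_1 satisfies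
   \sum_k lambda_k x_k dF_j / dx_k = (- lambda_1 lambda_j + lambda_j lambda_1) F_j = 0
   and does not depend on x_n, so it is invariant, and it is smooth because its
   partial derivatives are again products of F_j with powers of the x_i.
   With x_1 fixed, z = F(x) can be solved for x_2, ..., x_(n-1), so the F_j map
   open sets onto neighbourhoods and satisfy no relation. Finally the coadjoint
   matrix is nonzero only in its last row and column, so its generic rank is 2.
   The real and complex cases are treated together: of the exponential, only
   E (a + b) = E a * E b, E'(0) = 1 and a local inverse at 1 are needed. *)
Require Import Defs.
From HB Require Import structures.
From mathcomp Require Import all_boot all_order all_algebra.
From mathcomp Require Import all_classical all_reals all_analysis.
From mathcomp Require Import ring lra.

Import Order.TTheory GRing.Theory Num.Theory.
Import numFieldNormedType.Exports.

Local Open Scope classical_set_scope.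
Local Open Scope ring_scope.

Set Implicit Arguments.
Unset Strict Implicit.
Unset Printing Implicit Defensive.

(** * Functions of class C^k on an open set *)

Lemma near_eq_differentiable (K : numFieldType) (V W : normedModType K)
    (f g : V -> W) (x : V) :
  {near x, f =1 g} -> differentiable f x -> differentiable g x.
Proof.
have limx := @lim_id V (@norm_hausdorff _ V) x.
move=> fg /diffP[cf /funext]; rewrite limx => /eqaddoP df.
have gx : g x = f x by rewrite (nbhs_singleton fg).
(* The differential is defined by choice as some continuous linear map giving the first-order
   expansion, so one witness for [g] suffices, and ['d f x] is taken. The definition writes the base
   point as [lim (nbhs x)], which [limx] turns back into [x]. *)
apply/diffP; apply: (@getPex _ (fun df : {linear V -> W} => continuous df /\
  forall y, g y = g (lim (nbhs x)) + df (y - lim (nbhs x))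
                  +o_(y \near x) (y - lim (nbhs x)))).
exists ('d f x); split => //; rewrite limx.
suff: g = (fun y => g x + 'd f x (y - x)) +o_x (fun y => y - x).
  by move=> {1}-> y.
apply/eqaddoP => e e0; move: (df e e0); rewrite gx.
by apply: filterS2 fg => y fgy; rewrite /= !fctE fgy.
Qed.

Section smooth_functions.
Context {K : numFieldType} {n : nat}.
Implicit Types (U : set 'rV[K]_n) (F G : 'rV[K]_n -> K).

Lemma Ck_on_continuous k U F : Ck_on k U F -> continuous_on U F.
Proof.
by case: k => //= k [dF _] x Ux; exact/differentiable_continuous/dF.
Qed.

Lemma Ck_onW k U F : Ck_on k.+1 U F -> Ck_on k U F.
Proof.
elim: k F => [|k IH] F [dF pF]; first exact: (@Ck_on_continuous 1).
by split=> // j; apply: IH.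
Qed.

Lemma eq_on_near U F G x : open U -> {in U, F =1 G} -> U x -> {near x, F =1 G}.
Proof.
move=> oU FG Ux.
by near=> y; apply: FG; rewrite inE; near: y; exact: open_nbhs_nbhs.
Unshelve. all: by end_near. Qed.

Lemma eq_partial U F G j x : open U -> {in U, F =1 G} -> U x ->
  partial j F x = partial j G x.
Proof.
by move=> oU FG Ux; apply: near_eq_derive; exact: eq_on_near FG Ux.
Qed.

(** Formulas for partial derivatives hold only on [U], while functions are total. This transfer lets
    the inductions below replace a partial derivative by its formula on [U]. *)
Lemma eq_Ck_on k U F G : open U -> {in U, F =1 G} -> Ck_on k U F -> Ck_on k U G.
Proof.
move=> oU; elim: k F G => [|k IH] F G FG /=.
  move=> cF x Ux; rewrite /prop_for /continuous_at -(FG x (mem_set Ux)).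
  exact: cvg_trans (near_eq_cvg (eq_on_near oU FG Ux)) (cF x Ux).
move=> [dF pF]; split=> [x Ux|j].
  exact: near_eq_differentiable (eq_on_near oU FG Ux) (dF x Ux).
apply: IH (pF j) => x; rewrite inE => Ux; exact: eq_partial oU FG Ux.
Qed.

Lemma Ck_on_cst k U (c : K) : Ck_on k U (cst c).
Proof.
elim: k c => [|k IH] c /=; first by move=> x _; exact: cst_continuous.
split=> [x _|j]; first exact: differentiable_cst.
rewrite (_ : partial j (cst c) = cst 0) //.
by apply/funext => x; rewrite /partial derive_cst.
Qed.

Lemma Ck_onD k U F G : open U ->
  Ck_on k U F -> Ck_on k U G -> Ck_on k U (F \+ G).
Proof.
move=> oU; elim: k F G => [|k IH] F G /=.
  by move=> cF cG x Ux; apply: continuousD; [exact: cF|exact: cG].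
move=> [dF pF] [dG pG]; split=> [x Ux|j].
  by apply: differentiableD; [exact: dF|exact: dG].
apply: eq_Ck_on (IH _ _ (pF j) (pG j)) => // x; rewrite inE => Ux /=.
rewrite /partial (_ : F \+ G = F + G)// deriveD//.
  by apply: diff_derivable; exact: dF.
by apply: diff_derivable; exact: dG.
Qed.

Lemma partialM F G j x : differentiable F x -> differentiable G x ->
  partial j (F \* G) x = F x * partial j G x + G x * partial j F x.
Proof. by move=> dF dG; apply: deriveM; exact: diff_derivable. Qed.

Lemma Ck_onM k U F G : open U ->
  Ck_on k U F -> Ck_on k U G -> Ck_on k U (F \* G).
Proof.
move=> oU; elim: k F G => [|k IH] F G.
  by move=> cF cG x Ux; apply: continuousM; [exact: cF|exact: cG].
move=> CF CG; have [dF pF] := CF; have [dG pG] := CG; split=> [x Ux|j].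
  by apply: differentiableM; [exact: dF|exact: dG].
have := Ck_onD oU (IH _ _ (Ck_onW CF) (pG j)) (IH _ _ (Ck_onW CG) (pF j)).
apply: eq_Ck_on => // x; rewrite inE => Ux.
by rewrite partialM//; [exact: dF|exact: dG].
Qed.

Lemma derive_coord (i j : 'I_n) (x : 'rV[K]_n) :
  'D_(delta_mx 0 j) (fun y : 'rV[K]_n => y 0 i) x = (i == j)%:R.
Proof.
apply: cvg_lim => //; apply: cvg_near_cst.
near=> h; rewrite /= !mxE eqxx /= addrK scalerA mulVf ?scale1r//.
by near: h; exact: nbhs_dnbhs_neq.
Unshelve. all: by end_near. Qed.

(** The partial derivatives of $1/x_i$ are $0$ or $-(1/x_i)^2$, so class $C^k$ of the function
    itself yields class $C^k$ of its partials, and induction on [k] closes. *)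
Lemma Ck_on_invcoord k U i : open U -> (forall x, U x -> x 0 i != 0) ->
  Ck_on k U (fun x => (x 0 i)^-1).
Proof.
move=> oU U0; have dV x : U x -> differentiable (fun y : 'rV[K]_n => (y 0 i)^-1) x.
  by move=> Ux; apply: differentiableV; [exact: differentiable_coord|exact: U0].
elim: k => [|k IH] /=.
  by move=> x Ux; exact/differentiable_continuous/dV.
split=> // j; have := Ck_onM oU (Ck_on_cst k U (- (i == j)%:R)) (Ck_onM oU IH IH).
apply: eq_Ck_on => // x; rewrite inE => Ux.
rewrite /partial [RHS](@deriveV _ _ (fun y : 'rV[K]_n => y 0 i)) ?U0//; last first.
  by apply: diff_derivable; exact: differentiable_coord.
by rewrite derive_coord /GRing.scale /= -exprVn expr2 !mulNr; congr (- _); exact: mulrC.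
Qed.

(** Bootstrap: the equation writes each partial derivative as a product involving [F] itself, so [F]
    of class $C^k$ is automatically of class $C^{k+1}$. *)
Lemma smooth_on_log_partial U F (c : 'I_n -> K) : open U ->
  (forall x, U x -> differentiable F x) ->
  (forall x i, U x -> c i != 0 -> x 0 i != 0) ->
  (forall x i, U x -> partial i F x = c i * ((x 0 i)^-1 * F x)) ->
  smooth_on U F.
Proof.
move=> oU dF c0 pF; elim=> [|k IH].
  by move=> x Ux; exact/differentiable_continuous/dF.
(* If [c i = 0], the coordinate [x 0 i] may vanish on [U] (as $x_n$ may), so this partial is treated
   as the constant 0 instead of a product with $1/x_i$. *)
split=> // i; have [ci0|ci0] := eqVneq (c i) 0.
  apply: eq_Ck_on (Ck_on_cst k U 0) => // x; rewrite inE => Ux.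
  by rewrite pF// ci0 mul0r.
have Ui x (Ux : U x) : x 0 i != 0 by exact: c0.
have := Ck_onM oU (Ck_on_cst k U (c i)) (Ck_onM oU (Ck_on_invcoord k oU Ui) IH).
by apply: eq_Ck_on => // x; rewrite inE => Ux; rewrite pF.
Qed.

End smooth_functions.

(** * Exponentials and branches of powers *)

(* An exponential E given together with a local inverse L at 1: expR and ln
   over R, expC and the principal logarithm over R[i]. *)
Record exp_log (K : numFieldType) (E L : K -> K) : Prop := ExpLog {
  exp_logD : forall a b, E (a + b) = E a * E b;
  exp_log_derive0 : is_derive (0 : K) (1 : K) E 1;
  exp_log_log1 : L 1 = 0;
  exp_log_continuous : {for (1 : K), continuous L};
  exp_logK : \forall w \near (1 : K), E (L w) = w }.

(** For [E := expC] this unfolds to [power_branch]; for [E := expR] the real powers fit it with [l]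
    equal to $\ln x_i$. *)
Definition log_branch (K : numFieldType) (E : K -> K) (n : nat)
    (U : set 'rV[K]_n) (i : 'I_n) (a : K) (p : 'rV[K]_n -> K) : Prop :=
  exists2 l : 'rV[K]_n -> K, continuous_on U l &
    forall x, U x -> E (l x) = x 0 i /\ p x = E (a * l x).

Section exp_log_theory.
Context {K : numFieldType} {E L : K -> K} (EL : exp_log E L).

Lemma exp_log_exp0 : E 0 = 1.
Proof. by rewrite -{1}(exp_log_log1 EL) (nbhs_singleton (exp_logK EL)). Qed.

Lemma exp_log_neq0 a : E a != 0.
Proof.
apply/eqP => Ea0; have /eqP := exp_log_exp0.
by rewrite -(subrr a) (exp_logD EL)// Ea0 mul0r eq_sym oner_eq0.
Qed.

Lemma exp_logN a : E (- a) = (E a)^-1.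
Proof.
apply: (mulfI (exp_log_neq0 a)).
by rewrite -(exp_logD EL)// subrr exp_log_exp0 mulfV// exp_log_neq0.
Qed.

Lemma exp_log_quotient_cvg : (fun z => z^-1 * (E z - 1)) @ (0 : K)^' --> (1 : K).
Proof.
have [/cvg_ex[l dE] dE1] := exp_log_derive0 EL.
have l1 : l = 1 by rewrite -dE1; apply/esym/cvg_lim.
rewrite {}l1 in dE; apply: cvg_trans dE; apply: near_eq_cvg.
by near=> z; rewrite /= addr0 exp_log_exp0 /GRing.scale/= mulr1.
Unshelve. all: by end_near. Qed.

(** A nonzero [z] with [E z = 1] would make the quotient $(E(z)-1)/z$ vanish, although it tends to
    1. Excluding small periods replaces injectivity, which fails for the complex exponential. *)
Lemma exp_log_inj_near : \forall z \near (0 : K), E z = 1 -> z = 0.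
Proof.
have /cvgrPdist_lt/(_ 1 ltr01) := exp_log_quotient_cvg.
rewrite near_withinE => H; near=> z => Ez; apply/eqP/negPn/negP => z0.
have : z != 0 -> `|1 - z^-1 * (E z - 1)| < 1 by near: z; exact: H.
move=> /(_ z0).
by rewrite Ez subrr mulr0 subr0 normr1 ltxx.
Unshelve. all: by end_near. Qed.

Lemma exp_log_continuous0 : E @ (0 : K) --> (1 : K).
Proof.
have [dE _] := exp_log_derive0 EL; rewrite -exp_log_exp0.
by apply: differentiable_continuous; exact/derivable1_diffP.
Qed.

Lemma log_cvg0 : L @ (1 : K) --> (0 : K).
Proof. rewrite -(exp_log_log1 EL); exact: exp_log_continuous EL. Qed.

(** [L] is given only as a right inverse of [E]. It is also a left inverse near 0 because
    [L (E z) - z] is a period of [E] tending to 0, hence zero. *)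
Lemma log_expK : \forall z \near (0 : K), L (E z) = z.
Proof.
have LE0 : L (E z) @[z --> (0 : K)] --> (0 : K).
  by apply: cvg_comp exp_log_continuous0 _; exact: log_cvg0.
have d0 : L (E z) - z @[z --> (0 : K)] --> (0 : K).
  by rewrite -[X in _ --> X](subrr 0); apply: (cvgB LE0); exact: cvg_id.
have K1 := exp_log_continuous0 (exp_logK EL).
near=> z; apply/eqP; rewrite -subr_eq0; apply/eqP.
have : E (L (E z) - z) = 1.
  rewrite (exp_logD EL)// (_ : E (L (E z)) = E z); last by near: z.
  by rewrite -(exp_logD EL)// subrr exp_log_exp0.
near: z; exact: d0 exp_log_inj_near.
Unshelve. all: by end_near. Qed.

(** Put $\phi(t) = (E(t)-1)/t$, extended by $\phi(0)=1$, and $s = L(1+h)$. Then $h = s\phi(s)$ and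
    $E(as)-1 = as\phi(as)$, so the difference quotient is $a\phi(as)/\phi(s)$, which tends to $a$.
    Only continuity of [L] at 1 enters, not its derivative. *)
Lemma is_derive_exp_log (a : K) : is_derive (1 : K) (1 : K) (fun w => E (a * L w)) a.
Proof.
pose phi (t : K) : K := if t == 0 then 1 else t^-1 * (E t - 1).
have phiE t : E t - 1 = t * phi t.
  rewrite /phi; have [->|t0] := eqVneq t 0; first by rewrite exp_log_exp0 subrr mul0r.
  by rewrite mulVKf.
have phi0 : phi @ (0 : K) --> (1 : K).
  have phi00 : phi 0 = 1 by rewrite /phi eqxx.
  rewrite -phi00; apply/continuous_withinNx; rewrite phi00.
  apply: cvg_trans exp_log_quotient_cvg; apply: near_eq_cvg.
  near=> t; rewrite /phi ifF//; apply/negbTE; near: t; exact: nbhs_dnbhs_neq.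
have h1 : (h + 1) @[h --> (0 : K)] --> (1 : K).
  suff : (h + 1) @[h --> (0 : K)] --> (0 + 1 : K) by rewrite add0r.
  by apply: (cvgD cvg_id); exact: cvg_cst.
have L0 : L (h + 1) @[h --> (0 : K)] --> (0 : K) := cvg_comp _ _ h1 log_cvg0.
have aL0 : a * L (h + 1) @[h --> (0 : K)] --> (0 : K).
  by rewrite -[X in _ --> X](mulr0 a); apply: (cvgM (cvg_cst _) L0).
have K1 : \forall h \near (0 : K)^', E (L (h + 1)) = h + 1.
  by apply: nbhs_dnbhs; exact: h1 (exp_logK EL).
have lim : a * phi (a * L (h + 1)) / phi (L (h + 1)) @[h --> (0 : K)] --> a.
  rewrite -[X in _ --> X](mulr1 a) -[X in _ --> X](divr1 (a * 1)).
  apply: (cvgM (cvgM (cvg_cst _) (cvg_comp _ _ aL0 phi0))).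
  by apply: cvgV; [exact: oner_neq0|exact: (cvg_comp _ _ L0 phi0)].
suff main : (fun h : K => h^-1 *: (((fun w => E (a * L w)) \o shift 1) (h *: (1 : K)) -
     E (a * L 1))) @ (0 : K)^' --> a.
  by split; [apply: cvgP main|apply: cvg_lim].
apply: cvg_trans (@cvg_within_filter _ _ _ _ _ _ (fun h => h != 0) lim).
apply: near_eq_cvg; near=> h.
have h0 : h != 0 by near: h; exact: nbhs_dnbhs_neq.
have hE : E (L (h + 1)) = h + 1 by near: h.
rewrite /= /GRing.scale/= mulr1 (exp_log_log1 EL) mulr0 exp_log_exp0 phiE.
have hphi : h = L (h + 1) * phi (L (h + 1)) by rewrite -phiE hE addrK.
(* From $h = s\phi(s)$ and $h \neq 0$, both denominators $s$ and $\phi(s)$ are nonzero. *)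
move: (L (h + 1)) hphi => s hphi; move: h0.
rewrite {}hphi mulf_eq0 negb_or => /andP[s0 phis0].
by field; rewrite phis0.
Unshelve. all: by end_near. Qed.

(** The discrepancy $l(y) - l(x) - L(y_i/x_i)$ is a period of [E] tending to 0 as $y \to x$, hence
    vanishes near [x]. Any continuous branch is thus locally expressed through the single function
    [L]. *)
Lemma log_branch_near n (U : set 'rV[K]_n) i a p x : open U -> U x ->
  log_branch E U i a p ->
  \forall y \near x, p y = p x * E (a * L (y 0 i / x 0 i)).
Proof.
move=> oU Ux [l cl El].
have [xi px] := El x Ux.
have xi0 : x 0 i != 0 by rewrite -xi exp_log_neq0.
have q1 : (fun y : 'rV[K]_n => y 0 i / x 0 i) @ x --> (1 : K).
  have ci : (fun y : 'rV[K]_n => y 0 i) @ x --> x 0 i by exact: coord_continuous.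
  by rewrite -(mulfV xi0); apply: (cvgM ci); exact: cvg_cst.
have L0 := cvg_comp _ _ q1 log_cvg0.
have u0 : (fun y => l y - l x - L (y 0 i / x 0 i)) @ x --> (0 : K).
  rewrite -[X in _ --> X](subrr 0); apply: (cvgB _ L0).
  rewrite -(subrr (l x)); apply: (cvgB (cl x Ux)); exact: cvg_cst.
near=> y.
have Uy : U y by near: y; exact: open_nbhs_nbhs.
have [yi ->] := El y Uy; rewrite px -(exp_logD EL)// -mulrDr; congr (E (a * _)).
apply/eqP; rewrite addrC -subr_eq -subr_eq0; apply/eqP.
have : E (l y - l x - L (y 0 i / x 0 i)) = 1.
  rewrite !(exp_logD EL)// !exp_logN yi xi.
  rewrite (_ : E (L _) = y 0 i / x 0 i) ?mulfV//.
    by rewrite mulf_neq0 ?invr_eq0// -yi exp_log_neq0.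
  by near: y; exact: q1 (exp_logK EL).
by near: y; exact: u0 exp_log_inj_near.
Unshelve. all: by end_near. Qed.

Lemma log_branch_neq0 n (U : set 'rV[K]_n) i a p x :
  log_branch E U i a p -> U x -> x 0 i != 0 /\ p x != 0.
Proof.
by move=> [l _ El] Ux; have [<- ->] := El x Ux; split; exact: exp_log_neq0.
Qed.

(** By the local formula, [p] is near [x] a multiple of $w \mapsto E(aL(w))$ composed with $y
    \mapsto y_i/x_i$. The latter takes the value 1 at [x], where the derivative of the former is
    [a], and the chain rule applies. *)
Lemma log_branch_diff n (U : set 'rV[K]_n) i a p x : open U -> U x ->
  log_branch E U i a p ->
  differentiable p x /\
  forall j, partial j p x = (i == j)%:R * a * ((x 0 i)^-1 * p x).
Proof.
move=> oU Ux bp; have pE := log_branch_near oU Ux bp.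
have [xi0 _] := log_branch_neq0 bp Ux.
pose c (y : 'rV[K]_n) : K := y 0 i * (x 0 i)^-1.
pose psi (w : K) : K := E (a * L w).
have cx : c x = 1 by rewrite /c mulfV.
have dc : differentiable c x.
  by apply: differentiableM; [exact: differentiable_coord|exact: differentiable_cst].
have [dpsi psi'] := is_derive_exp_log a.
have dfpsi : differentiable psi (c x) by rewrite cx; apply/derivable1_diffP.
have df : differentiable (p x \*: (psi \o c)) x.
  by apply: differentiableZ; exact: differentiable_comp.
have fp : {near x, p x \*: (psi \o c) =1 p} by apply: filterS pE.
split=> [|j]; first exact: near_eq_differentiable fp df.
rewrite /partial -(near_eq_derive _ fp) deriveZ; last first.
  by apply: diff_derivable; exact: differentiable_comp.
rewrite deriveE; last exact: differentiable_comp.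
rewrite diff_comp//= deriv1E; last by rewrite cx.
rewrite derive1E cx psi' -deriveE//.
rewrite (_ : c = (x 0 i)^-1 \*: (fun y : 'rV[K]_n => y 0 i)); last first.
  by apply/funext => y; rewrite /c mulrC.
rewrite deriveZ; last by apply: diff_derivable; exact: differentiable_coord.
by rewrite derive_coord /GRing.scale /=; ring.
Qed.

End exp_log_theory.

(** * Functional independence of products of branches *)

Section independence.
Context {K : numFieldType} {E L : K -> K} (EL : exp_log E L).

(* The map is locally onto since it has the explicit right inverse
   x_(idx j) = x0_(idx j) * E (L (z_j / z0_j) / b), continuous at z0. *)
Lemma log_branch_independent n m (U : set 'rV[K]_n) (i0 : 'I_n)
    (idx : 'I_m -> 'I_n) (a : 'I_m -> K) (b : K) (p q : 'I_m -> 'rV[K]_n -> K) :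
  open U -> injective idx -> (forall j, idx j != i0) -> b != 0 ->
  (forall j, log_branch E U i0 (a j) (p j)) ->
  (forall j, log_branch E U (idx j) b (q j)) ->
  functionally_independent U (fun j x => p j x * q j x).
Proof.
move=> oU idx_inj idx0 b0 bp bq V oV [x Vx] VU W Phi oW _ VPhi.
have Ux := VU _ Vx.
pose F j y := p j y * q j y; pose z0 : 'rV[K]_m := \row_j F j x.
have F0 j : F j x != 0.
  have [_ p0] := log_branch_neq0 EL (bp j) Ux.
  by have [_ q0] := log_branch_neq0 EL (bq j) Ux; rewrite mulf_neq0.
pose s (z : 'rV[K]_m) (j : 'I_m) := L (z 0 j / F j x).
(* Injectivity of [idx] makes the picked [j] unique. Coordinates outside the image of [idx], among
   them [i0], keep their value at [x]. *)
pose g (z : 'rV[K]_m) : 'rV[K]_n :=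
  \row_k (if [pick j | idx j == k] is Some j then x 0 k * E (b^-1 * s z j)
          else x 0 k).
have g_idx z j : g z 0 (idx j) = x 0 (idx j) * E (b^-1 * s z j).
  rewrite mxE; case: pickP => [j' /eqP/idx_inj -> //|/(_ j)].
  by rewrite eqxx.
have g_i0 z : g z 0 i0 = x 0 i0.
  by rewrite mxE; case: pickP => // j; rewrite (negbTE (idx0 j)).
have z1 j : (fun z : 'rV[K]_m => z 0 j / F j x) @ z0 --> (1 : K).
  have cj : (fun z : 'rV[K]_m => z 0 j) @ z0 --> F j x.
    by have := @coord_continuous K 1 m 0 j z0; rewrite /continuous_at mxE.
  by rewrite -[X in _ --> X](mulfV (F0 j)); apply: (cvgM cj); exact: cvg_cst.
have s0 j : s z j @[z --> z0] --> (0 : K) := cvg_comp _ _ (z1 j) (log_cvg0 EL).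
have bs0 j : b^-1 * s z j @[z --> z0] --> (0 : K).
  by rewrite -[X in _ --> X](mulr0 b^-1); apply: (cvgM (cvg_cst _) (s0 j)).
have cg : g @ z0 --> x.
  move=> A [P xP PA].
  have Pk k : \forall z \near z0, P 0 k (g z 0 k).
    have [[j <-]|nk] := pselect (exists j, idx j = k); last first.
      near=> z; rewrite mxE; case: pickP => [j /eqP jk|_]; first by case: nk; exists j.
      exact: nbhs_singleton.
    have : x 0 (idx j) * E (b^-1 * s z j) @[z --> z0] --> x 0 (idx j) * 1.
      have e1 : E (b^-1 * s z j) @[z --> z0] --> (1 : K).
        exact: cvg_comp _ _ (bs0 j) (exp_log_continuous0 EL).
      exact: (cvgM (cvg_cst _) e1).
    rewrite mulr1 => /(_ _ (xP 0 (idx j))) xPj.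
    have {}xPj : \forall z \near z0, P 0 (idx j) (x 0 (idx j) * E (b^-1 * s z j)) := xPj.
    by apply: filterS xPj => z; rewrite -g_idx.
  have Pa : \forall z \near z0, forall k, P 0 k (g z 0 k).
    exact: (@filter_forall _ _ (fun k z => P 0 k (g z 0 k)) (nbhs z0) _ Pk).
  by apply: filterS Pa => z Pz; apply: PA => i k; rewrite ord1.
(* Along [g] the coordinate [i0] is constant, so [p j] keeps its value at [x]. The factor [q j] is
   multiplied by $E(b\,b^{-1}s_j) = z_j/F_j(x)$, which brings the product to $z_j$. *)
have Fg j : \forall z \near z0, F j (g z) = z 0 j.
  have pg : \forall z \near z0,
      p j (g z) = p j x * E (a j * L (g z 0 i0 / x 0 i0)).
    exact: cg (log_branch_near EL oU Ux (bp j)).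
  have qg : \forall z \near z0,
      q j (g z) = q j x * E (b * L (g z 0 (idx j) / x 0 (idx j))).
    exact: cg (log_branch_near EL oU Ux (bq j)).
  have bsK : \forall z \near z0, L (E (b^-1 * s z j)) = b^-1 * s z j.
    exact: (bs0 j) (log_expK EL).
  have zK : \forall z \near z0, E (s z j) = z 0 j / F j x.
    exact: (z1 j) (exp_logK EL).
  near=> z.
  have xi0 := (log_branch_neq0 EL (bp j) Ux).1.
  have xj0 := (log_branch_neq0 EL (bq j) Ux).1.
  have pz : p j (g z) = p j x.
    have -> : p j (g z) = p j x * E (a j * L (g z 0 i0 / x 0 i0)) by near: z.
    by rewrite g_i0 mulfV// (exp_log_log1 EL) mulr0 (exp_log_exp0 EL) mulr1.
  have qz : q j (g z) = q j x * (z 0 j / F j x).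
    have -> : q j (g z) = q j x * E (b * L (g z 0 (idx j) / x 0 (idx j))) by near: z.
    rewrite g_idx mulrAC mulfV// mul1r.
    have -> : L (E (b^-1 * s z j)) = b^-1 * s z j by near: z.
    by rewrite mulVKf//; congr (_ * _); near: z.
  by rewrite /F pz qz mulrA -/(F j x) mulrC divfK.
have Vg : \forall z \near z0, V (g z) by apply: cg; exact: open_nbhs_nbhs.
have FgE z : (forall j, F j (g z) = z 0 j) -> \row_j F j (g z) = z.
  by move=> Fgz; apply/rowP => j; rewrite mxE Fgz.
(* The interior supplies openness and still contains [z0], since both conditions hold near [z0]. *)
exists [set z | V (g z) /\ forall j, F j (g z) = z 0 j]°; split.
- exact: open_interior.
- by exists z0; apply: filterI => //; exact: filter_forall Fg.
- move=> z /interior_subset [/VPhi[Wz _] Fgz].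
  by rewrite -(FgE z Fgz).
- move=> z /interior_subset [/VPhi[_ Pz] Fgz].
  by rewrite -(FgE z Fgz).
Unshelve. all: by end_near. Qed.

End independence.

(** * The Lie algebra *)

Lemma ab_idx_inj m : injective (@ab_idx m).
Proof. by move=> k l /(congr1 val) /= kl; exact: val_inj. Qed.

Lemma ab_idx_neq_max m (k : 'I_m.+1) : (ab_idx k == ord_max) = false.
Proof. by apply/eqP => /(congr1 val) /= k1; have := ltn_ord k; rewrite k1 ltnn. Qed.

Variant ab_idx_spec m : 'I_m.+2 -> Type :=
  | AbIdx (k : 'I_m.+1) : ab_idx_spec (ab_idx k)
  | AbMax : ab_idx_spec ord_max.

Lemma ab_idxP m (i : 'I_m.+2) : ab_idx_spec i.
Proof.
case: (unliftP ord_max i) => [k|] ->; last exact: AbMax.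
suff -> : lift ord_max k = ab_idx k by exact: AbIdx.
by apply: val_inj; exact: lift_max.
Qed.

Section diagonal_algebra.
Context {K : numFieldType} {g : vectType K} {br : g -> g -> g} {m : nat}
  {e : m.+2.-tuple g} {lambda : 'I_m.+1 -> K}.
Context (lambda0 : forall k, lambda k != 0) (lie : is_lie_bracket br)
  (basis_e : basis_of fullv e) (rel : diagonal_relations br e lambda).

Lemma bracket_skew u v : br v u = - br u v.
Proof.
have [brl brr br0 _] := lie.
have addl x y w : br (x + y) w = br x w + br y w.
  by have := brl 1 x y w; rewrite !scale1r.
have addr x y w : br w (x + y) = br w x + br w y.
  by have := brr 1 x y w; rewrite !scale1r.
apply/eqP; rewrite -addr_eq0 addrC.
by have := br0 (u + v); rewrite addl !addr !br0 add0r addr0 => ->.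
Qed.

Lemma coord_tnth_basis (i j : 'I_m.+2) : coord e i (tnth e j) = (i == j)%:R.
Proof. by rewrite (tnth_nth 0) coord_free 1?eq_sym// (basis_free basis_e). Qed.

Lemma coadjoint_matrix_ab_max x k :
  coadjoint_matrix br e x (ab_idx k) ord_max = lambda k * x 0 (ab_idx k).
Proof.
have [relm _] := rel; rewrite mxE (bigD1 (ab_idx k))//= big1 ?addr0.
  by rewrite /structure_constant relm linearZ/= coord_tnth_basis eqxx mulr1.
move=> l /negbTE kl; rewrite /structure_constant relm linearZ/=.
by rewrite coord_tnth_basis kl mulr0 mul0r.
Qed.

Lemma coadjoint_matrix_skew x i j :
  coadjoint_matrix br e x j i = - coadjoint_matrix br e x i j.
Proof.
rewrite !mxE -sumrN; apply: eq_bigr => k _.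
by rewrite /structure_constant bracket_skew linearN mulNr.
Qed.

Lemma coadjoint_matrix_diag x i : coadjoint_matrix br e x i i = 0.
Proof.
have [_ _ br0 _] := lie; rewrite mxE big1// => k _.
by rewrite /structure_constant br0 linear0 mul0r.
Qed.

Lemma coadjoint_matrix_ab_ab x k l :
  coadjoint_matrix br e x (ab_idx k) (ab_idx l) = 0.
Proof.
have [_ rel0] := rel; rewrite mxE big1// => j _.
by rewrite /structure_constant rel0 linear0 mul0r.
Qed.

(** With $C$ the last column and $d$ the last unit row vector, the matrix equals $Cd - d^TC^T$, a
    difference of two matrices of rank at most 1. *)
Lemma coadjoint_matrix_rank_le x : (\rank (coadjoint_matrix br e x) <= 2)%N.
Proof.
move: (coadjoint_matrix br e x) (coadjoint_matrix_ab_ab x)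
  (coadjoint_matrix_skew x) (coadjoint_matrix_diag x) => A Aab Ask A0.
set d : 'rV[K]_m.+2 := delta_mx 0 ord_max.
have -> : A = col ord_max A *m d - (d^T *m (col ord_max A)^T).
  apply/matrixP => i j; rewrite !mxE !big_ord1 !mxE !eqxx.
  case: (ab_idxP i) => [k|]; case: (ab_idxP j) => [l|];
    rewrite ?ab_idx_neq_max ?eqxx ?mulr0 ?mul0r ?subr0 ?mulr1 ?mul1r ?sub0r//.
  by rewrite A0 subrr.
apply: leq_trans (mxrank_add _ _) _; rewrite mxrank_opp.
by apply: (@leq_add _ _ 1 1); exact: mulmx_max_rank.
Qed.

Lemma coadjoint_matrix_rank_ones :
  \rank (coadjoint_matrix br e (const_mx 1)) = 2%N.
Proof.
apply/eqP; rewrite eqn_leq coadjoint_matrix_rank_le /=.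
set A := coadjoint_matrix _ _ _.
(* Rows $(1,n)$ and columns $(n,1)$, in this swapped order, give the diagonal minor with entries
   $\lambda_1, -\lambda_1$. [D] below is its inverse, so the rank is at least 2. *)
pose f (i : 'I_2) : 'I_m.+2 := if i == 0 then ab_idx ord0 else ord_max.
pose h (i : 'I_2) : 'I_m.+2 := if i == 0 then ord_max else ab_idx ord0.
pose l := lambda ord0.
have l0 : l != 0 by exact: lambda0.
pose D : 'M[K]_2 := diag_mx (\row_i if i == 0 then l^-1 else - l^-1).
apply: (@mulmx1_min_rank _ 2 _ _ A (rowsub f 1%:M) (colsub h 1%:M *m D)).
rewrite -rowsubE mulmxA mulmx_colsub mulmx1; apply/matrixP => i j.
have A1 k : A (ab_idx k) ord_max = lambda k.
  by rewrite coadjoint_matrix_ab_max mxE mulr1.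
have A2 k : A ord_max (ab_idx k) = - lambda k.
  by rewrite coadjoint_matrix_skew -/A A1.
move: A (coadjoint_matrix_ab_ab (const_mx 1) : forall k l, A _ _ = 0)
 (coadjoint_matrix_diag (const_mx 1) : forall i, A i i = 0) A1 A2 => A Aab A0 A1 A2.
rewrite mul_mx_diag !mxE.
case: i => [[|[|//]] i2]; case: j => [[|[|//]] j2]; rewrite /f /h /= ?Aab ?A0 ?A1 ?A2;
  by rewrite ?mul0r ?mulrNN ?mulfV.
Qed.

Lemma number_of_invariants_diagonal : number_of_invariants br e = m.
Proof.
have dimg : \dim {: g} = m.+2 by exact: size_basis basis_e.
rewrite /number_of_invariants dimg.
rewrite (_ : (\max_(r < _ | _) r)%N = 2%N) ?subn2//.
apply/eqP; rewrite eqn_leq; apply/andP; split.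
  apply/bigmax_leqP => r /asboolP[x <-]; exact: coadjoint_matrix_rank_le.
apply: (@leq_bigmax_cond _ _ (fun r : 'I_m.+3 => r : nat) (Ordinal (isT : (2 < m.+3)%N))).
by apply/asboolP; exists (const_mx 1); exact: coadjoint_matrix_rank_ones.
Qed.

(** The vector [c] lists the exponents of a monomial. The first $n-1$ equations involve only
    $\partial F/\partial x_n$, killed by [c ord_max = 0]; the last one reads $-(\sum_k \lambda_k
    c_k)F = 0$. *)
Lemma diagonal_invariant (U : set 'rV[K]_m.+2) F (c : 'I_m.+2 -> K) :
  open U -> (forall x, U x -> differentiable F x) ->
  (forall x i, U x -> c i != 0 -> x 0 i != 0) ->
  (forall x i, U x -> partial i F x = c i * ((x 0 i)^-1 * F x)) ->
  c ord_max = 0 -> \sum_k lambda k * c (ab_idx k) = 0 ->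
  is_invariant br e U F.
Proof.
move=> oU dF c0 pF cmax csum; split; first exact: smooth_on_log_partial dF c0 pF.
move=> x Ux i.
transitivity (\sum_j coadjoint_matrix br e x i j * partial j F x).
  by apply: eq_bigr => j _; rewrite mxE mulr_suml.
rewrite big_ord_recr /= (pF _ ord_max)// cmax mul0r mulr0 addr0.
case: (ab_idxP i) => [k|].
  by rewrite big1// => l _; rewrite coadjoint_matrix_ab_ab mul0r.
transitivity (- (\sum_k lambda k * c (ab_idx k)) * F x); last first.
  by rewrite csum oppr0 mul0r.
rewrite -sumrN mulr_suml; apply: eq_bigr => k _; rewrite -/(ab_idx k).
rewrite coadjoint_matrix_skew coadjoint_matrix_ab_max pF//.
have [->|ck0] := eqVneq (c (ab_idx k)) 0; first by rewrite !(mul0r, mulr0, oppr0).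
have xk0 := c0 _ _ Ux ck0.
by field.
Qed.

End diagonal_algebra.

(** Common form of the real and complex statements. The ordinal [j : 'I_m] stands for the basis
    vector $e_{j+2}$, reached by [lift ord0 j]. *)
Lemma basis_of_invariants_branches (K : numFieldType) (E L : K -> K)
    (EL : exp_log E L) (m : nat) (lambda : 'I_m.+1 -> K) (g : vectType K)
    (br : g -> g -> g) (e : m.+2.-tuple g) (U : set 'rV[K]_m.+2)
    (p q : 'I_m -> 'rV[K]_m.+2 -> K) :
  (forall k, lambda k != 0) ->
  is_lie_bracket br -> basis_of fullv e -> diagonal_relations br e lambda ->
  open U ->
  (forall j, log_branch E U (ab_idx ord0) (- lambda (lift ord0 j)) (p j)) ->
  (forall j, log_branch E U (ab_idx (lift ord0 j)) (lambda ord0) (q j)) ->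
  basis_of_invariants br e U (fun j x => p j x * q j x).
Proof.
move=> lambda0 lie be rel oU bp bq; split; last first.
- exact/esym/(number_of_invariants_diagonal lambda0 lie be rel).
- apply: (log_branch_independent EL oU _ _ (lambda0 ord0) bp bq).
    by move=> j l /ab_idx_inj/lift_inj.
  by move=> j; apply/eqP => /ab_idx_inj/eqP; rewrite eq_sym (negbTE (neq_lift _ _)).
(* Exponent vector of the [j]-th product: minus the eigenvalue of [lift ord0 j] in the first slot,
   $\lambda_1$ in the slot of [lift ord0 j], and 0 elsewhere. *)
move=> j; pose c i : K := (ab_idx ord0 == i)%:R * - lambda (lift ord0 j) +
  (ab_idx (lift ord0 j) == i)%:R * lambda ord0.
have dp x Ux := log_branch_diff EL (x := x) oU Ux (bp j).
have dq x Ux := log_branch_diff EL (x := x) oU Ux (bq j).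
apply: (diagonal_invariant lie be rel (c := c)) => //.
- by move=> x Ux; apply: differentiableM; [have [] := dp x Ux|have [] := dq x Ux].
- move=> x i Ux; rewrite /c.
  have [<- _|_] := eqVneq (ab_idx ord0) i.
    exact: (log_branch_neq0 EL (bp j) Ux).1.
  have [<- _|_] := eqVneq (ab_idx (lift ord0 j)) i.
    exact: (log_branch_neq0 EL (bq j) Ux).1.
  by rewrite !mul0r addr0 eqxx.
- move=> x i Ux; have [dpx pp] := dp x Ux; have [dqx pq] := dq x Ux.
  rewrite [LHS]partialM// pp pq /c.
  by case: eqP => [->|_]; case: eqP => [->|_] /=; ring.
- by rewrite /c !ab_idx_neq_max !mul0r addr0.
- rewrite (bigD1 ord0)//= (bigD1 (lift ord0 j))//= big1 /c ?addr0 => [|k].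
    rewrite !eqxx !(inj_eq (@ab_idx_inj m)) (eq_sym (lift ord0 j)).
    by rewrite (negbTE (neq_lift _ _)) /=; ring.
  rewrite !(inj_eq (@ab_idx_inj m)) ![_ == k]eq_sym => /andP[/negbTE-> /negbTE->].
  by rewrite !mul0r addr0 mulr0.
Qed.

(** * The real and the complex exponential *)

Lemma exp_log_real (R : realType) : exp_log (@expR R) (@ln R).
Proof.
split; first exact: expRD.
- by have := is_derive_expR (0 : R); rewrite expR0.
- exact: ln1.
- exact: continuous_ln.
- near=> w; apply: lnK; rewrite posrE; near: w; exact: (lt_nbhsr ltr01).
Unshelve. all: by end_near. Qed.

(** Division-free form of the derivative at 0, true also at $h = 0$; real estimates in this form
    combine directly into a complex one. *)
Lemma is_derive0P (K : numFieldType) (f : K -> K) (d : K) :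
  is_derive (0 : K) (1 : K) f d <->
  forall e, 0 < e -> \forall h \near (0 : K), `|f h - f 0 - d * h| <= e * `|h|.
Proof.
have bound e h : h != 0 ->
    (`|d - h^-1 *: ((f \o shift (0 : K)) (h *: (1 : K)) - f 0)| <= e) =
    (`|f h - f 0 - d * h| <= e * `|h|).
  move=> h0; rewrite /= addr0 /GRing.scale /= mulr1 distrC.
  by rewrite -(ler_pM2r (_ : 0 < `|h|)) ?normr_gt0// -normrM mulrBl mulrAC mulVf// mul1r.
split=> [[/cvg_ex[l df] dE] e e0|H].
  have ld : l = d by rewrite -dE; apply/esym/cvg_lim.
  move: df; rewrite {}ld => /cvgrPdist_le/(_ e e0); rewrite near_withinE.
  apply: filterS => h; have [->|h0 /(_ isT)] := eqVneq h 0; last by rewrite bound.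
  by rewrite !(mulr0, subrr, normr0).
suff main : (fun h : K => h^-1 *: ((f \o shift 0) (h *: (1 : K)) - f 0))
    @ (0 : K)^' --> d.
  by split; [apply: cvgP main|apply: cvg_lim].
apply/cvgrPdist_le => e e0; rewrite near_withinE.
by apply: filterS (H e e0) => h He h0; rewrite bound.
Qed.

(* The topology of R[i] is attached to numFieldType, not to the bare type R[i]. *)
Definition complex_field (R : realType) : numFieldType := R[i].

Section complex_exp.
Context {R : realType}.
Local Notation C := (complex_field R).

(** The principal logarithm on the half-plane of positive real part, where the argument is
    $\arctan(y/x)$; a neighbourhood of 1 is all that [exp_log] requires. *)
Definition logC (z : R[i]) : R[i] :=
  Complex (ln (Num.sqrt (complex.Re z ^+ 2 + complex.Im z ^+ 2)))
          (atan (complex.Im z / complex.Re z)).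

Lemma normc_le_ReIm (z : R[i]) : `|z| <= (`|complex.Re z| + `|complex.Im z|)%:C%C.
Proof.
rewrite normc_def lecR -(@ler_pXn2r _ 2)// ?nnegrE ?sqrtr_ge0 ?addr_ge0//.
rewrite sqr_sqrtr ?addr_ge0 ?sqr_ge0// sqrrD !real_normK ?num_real//.
by rewrite -addrA lerD2l lerDr mulrn_wge0// mulr_ge0.
Qed.

Lemma normc_ge_Im (z : R[i]) : `|complex.Im z|%:C%C <= `|z|.
Proof.
rewrite normc_def lecR -sqrtr_sqr ler_wsqrtr// lerDr; exact: sqr_ge0.
Qed.

Lemma posC_real (e : R[i]) : 0 < e -> exists2 r : R, 0 < r & e = r%:C%C.
Proof. by case: e => r s; rewrite ltcE /= => /andP[/eqP -> r0]; exists r. Qed.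

Lemma continuous_Re (z : C) : (@complex.Re R : C -> R) @ z --> complex.Re z.
Proof.
apply/(@cvgrPdist_le R R C (nbhs z)) => e e0.
have e0C : 0 < (e%:C%C : C) by rewrite ltcR.
have /cvgrPdist_le/(_ _ e0C) : id @ z --> (z : C) by exact: cvg_id.
apply: filterS => w wz; rewrite -lecR; apply: le_trans wz.
have -> : complex.Re z - complex.Re w = complex.Re (z - w) by case: z w => ? ? [].
exact: normc_ge_Re.
Qed.

Lemma continuous_Im (z : C) : (@complex.Im R : C -> R) @ z --> complex.Im z.
Proof.
apply/(@cvgrPdist_le R R C (nbhs z)) => e e0.
have e0C : 0 < (e%:C%C : C) by rewrite ltcR.
have /cvgrPdist_le/(_ _ e0C) : id @ z --> (z : C) by exact: cvg_id.
apply: filterS => w wz; rewrite -lecR; apply: le_trans wz.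
have -> : complex.Im z - complex.Im w = complex.Im (z - w) by case: z w => ? ? [].
exact: normc_ge_Im.
Qed.

Lemma cvg_Complex (T : Type) (F : set_system T) (FF : Filter F)
    (f g : T -> R) (a b : R) :
  f @ F --> a -> g @ F --> b ->
  (fun t => Complex (f t) (g t) : C) @ F --> (Complex a b : C).
Proof.
move=> fa gb; apply/(@cvgrPdist_le C C T F) => _ /posC_real[e e0 ->].
have e20 : 0 < e / 2 by rewrite divr_gt0.
near=> t; apply: le_trans (normc_le_ReIm _) _; rewrite lecR /= [leRHS]splitr.
apply: lerD; near: t; exact: cvgr_dist_le.
Unshelve. all: by end_near. Qed.

Lemma expCD (a b : R[i]) : expC (a + b) = expC a * expC b.
Proof.
case: a b => [a1 a2] [b1 b2]; apply/eqP; rewrite eq_complex /=.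
by rewrite expRD cosD sinD; apply/andP; split; apply/eqP; ring.
Qed.

Lemma expC_derive0 : is_derive (0 : C) (1 : C) (@expC R : C -> C) 1.
Proof.
have expC0 : expC (0 : C) = 1.
  by apply/eqP; rewrite eq_complex /= expR0 cos0 sin0 mulr1 mulr0 !eqxx.
apply/is_derive0P => _ /posC_real[e e0 ->]; rewrite expC0.
(* With $h = x+iy$, the real part of the error is at most $2d|y| + d|x|$ and the imaginary part at
   most $2d|y| + d|y|$. Since $|x|, |y| \le |h|$, the total is at most $6d|h|$. *)
pose d := e / 6; have d0 : 0 < d by rewrite divr_gt0.
have bexp := (is_derive0P _ _).1 (is_derive_expR (0 : R)) _ d0.
have bsin := (is_derive0P _ _).1 (is_derive_sin (0 : R)) _ d0.
have bcos := (is_derive0P _ _).1 (is_derive_cos (0 : R)) _ d0.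
have cexp := @continuous_expR R 0.
have exp1 : \forall x \near (0 : R), `|expR x - 1| <= d.
  by move/cvgrPdist_le/(_ d d0): cexp; apply: filterS => x; rewrite expR0 distrC.
have exp2 : \forall x \near (0 : R), expR x <= 2.
  by move/cvgr_le: cexp; apply; rewrite expR0 ltr1n.
have Re0 : (@complex.Re R : C -> R) @ (0 : C) --> (0 : R) by exact: continuous_Re.
have Im0 : (@complex.Im R : C -> R) @ (0 : C) --> (0 : R) by exact: continuous_Im.
have nRe : \forall h \near (0 : C),
    `|expR (complex.Re h) - expR 0 - expR 0 * complex.Re h| <= d * `|complex.Re h| /\
    `|expR (complex.Re h) - 1| <= d /\ expR (complex.Re h) <= 2.
  exact: Re0 _ (filterI bexp (filterI exp1 exp2)).
have nIm : \forall h \near (0 : C),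
    `|sin (complex.Im h) - sin 0 - cos 0 * complex.Im h| <= d * `|complex.Im h| /\
    `|cos (complex.Im h) - cos 0 - - sin 0 * complex.Im h| <= d * `|complex.Im h|.
  exact: Im0 _ (filterI bsin bcos).
apply: filterS2 nRe nIm => -[x y] /=.
rewrite expR0 sin0 cos0 oppr0 mul0r !(addr0, subr0) !mul1r => -[ex [ex1 ex2]] [sy cy].
apply: le_trans (normc_le_ReIm _) _; rewrite normc_def -rmorphM lecR /=.
have xh : `|x| <= Num.sqrt (x ^+ 2 + y ^+ 2).
  by rewrite -sqrtr_sqr ler_wsqrtr// lerDl sqr_ge0.
have yh : `|y| <= Num.sqrt (x ^+ 2 + y ^+ 2).
  by rewrite -sqrtr_sqr ler_wsqrtr// lerDr sqr_ge0.
have Re_le : `|expR x * cos y - 1 - x| <= 2 * (d * `|y|) + d * `|x|.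
  have -> : expR x * cos y - 1 - x = expR x * (cos y - 1) + (expR x - 1 - x) by ring.
  apply: le_trans (ler_normD _ _) _; apply: lerD ex.
  by rewrite normrM; apply: ler_pM => //; rewrite ger0_norm ?expR_ge0.
have Im_le : `|expR x * sin y - 0 - y| <= 2 * (d * `|y|) + d * `|y|.
  have -> : expR x * sin y - 0 - y = expR x * (sin y - y) + (expR x - 1) * y by ring.
  apply: le_trans (ler_normD _ _) _; apply: lerD.
    by rewrite normrM; apply: ler_pM => //; rewrite ger0_norm ?expR_ge0.
  by rewrite normrM ler_wpM2r.
apply: le_trans (lerD Re_le Im_le) _.
have -> : e = 6 * d by rewrite /d mulrC divfK.
nra.
Qed.

Lemma logC_continuous1 : {for (1 : C), continuous (logC : C -> C)}.
Proof.
have Re1 : (@complex.Re R : C -> R) @ (1 : C) --> (1 : R) by exact: continuous_Re.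
have Im1 : (@complex.Im R : C -> R) @ (1 : C) --> (0 : R) by exact: continuous_Im.
have norm1 : (fun z : C => complex.Re z ^+ 2 + complex.Im z ^+ 2) @ (1 : C) --> (1 : R).
  suff : (fun z : C => complex.Re z ^+ 2 + complex.Im z ^+ 2) @ (1 : C)
    --> (1 * 1 + 0 * 0 : R) by rewrite mulr1 mulr0 addr0.
  exact: (cvgD (cvgM Re1 Re1) (cvgM Im1 Im1)).
have sqrt1 : (fun z : C => Num.sqrt (complex.Re z ^+ 2 + complex.Im z ^+ 2)) @ (1 : C)
    --> (1 : R).
  by rewrite -[X in _ --> X]sqrtr1; exact: cvg_comp _ _ norm1 (@sqrt_continuous R 1).
have slope0 : (fun z : C => complex.Im z / complex.Re z) @ (1 : C) --> (0 : R).
  rewrite -[X in _ --> X](mul0r (1^-1 : R)).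
  by apply: (cvgM Im1); apply: cvgV => //; exact: oner_neq0.
rewrite /prop_for /continuous_at; have -> : logC 1 = Complex (ln 1) (atan 0) :> C.
  by rewrite /logC /= expr1n expr0n addr0 sqrtr1 mul0r.
have ln1 : @ln R @ (1 : R) --> ln (1 : R) by exact: continuous_ln.
have atan0 : @atan R @ (0 : R) --> atan (0 : R) by exact: continuous_atan.
exact: (cvg_Complex _ (cvg_comp _ _ sqrt1 ln1) (cvg_comp _ _ slope0 atan0)).
Qed.

(** With $t = y/x$ and $x > 0$, the modulus is $x\sqrt{1+t^2}$, while $\cos(\arctan t) =
    1/\sqrt{1+t^2}$ and $\sin(\arctan t) = t\cos(\arctan t)$; the square roots cancel. *)
Lemma logCK (z : R[i]) : 0 < complex.Re z -> expC (logC z) = z.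
Proof.
case: z => x y /= x0; rewrite /expC /logC /=.
set t := y / x; have xt : y = x * t by rewrite /t mulrC divfK// gt_eqF.
have t0 : 0 < 1 + t ^+ 2 by rewrite ltr_wpDr ?sqr_ge0.
have sE : Num.sqrt (x ^+ 2 + y ^+ 2) = x * Num.sqrt (1 + t ^+ 2).
  rewrite xt exprMn -{1}[x ^+ 2]mulr1 -mulrDr sqrtrM ?sqr_ge0//.
  by rewrite sqrtr_sqr gtr0_norm.
have s0 : 0 < Num.sqrt (1 + t ^+ 2) by rewrite sqrtr_gt0.
rewrite sE lnK ?posrE ?mulr_gt0//.
have cosE := cos_atan t.
have sinE : sin (atan t) = t * cos (atan t).
  by rewrite -{2}(atanK t) /tan divfK// cosE invr_eq0 gt_eqF.
rewrite sinE cosE; congr Complex.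
  by rewrite mulfK// gt_eqF.
by rewrite mulrCA mulfK ?gt_eqF// mulrC.
Qed.

Lemma exp_log_complex : exp_log (@expC R : C -> C) logC.
Proof.
split; [exact: expCD|exact: expC_derive0| |exact: logC_continuous1|].
  by rewrite /logC /= expr1n expr0n addr0 sqrtr1 ln1 mul0r atan0.
have /cvgr_gt/(_ _ ltr01) := @continuous_Re (1 : C).
by apply: filterS => w; exact: logCK.
Qed.

End complex_exp.

Theorem mainTheorem5 (R : realType) (m : nat) :
  (forall (lambda : 'I_m.+1 -> R) (g : vectType R) (br : g -> g -> g)
     (e : m.+2.-tuple g),
     (forall k, lambda k != 0) ->
     is_lie_bracket br -> basis_of fullv e -> diagonal_relations br e lambda ->
     forall U : set 'rV[R]_m.+2,
       domain U ->
       (forall x, U x -> forall k : 'I_m.+1, 0 < x 0 (ab_idx k)) ->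
       basis_of_invariants br e U
         (fun (j : 'I_m) (x : 'rV[R]_m.+2) =>
            x 0 (ab_idx ord0) `^ (- lambda (lift ord0 j)) *
            x 0 (ab_idx (lift ord0 j)) `^ lambda ord0)) /\
  (forall (lambda : 'I_m.+1 -> R[i]) (g : vectType R[i]) (br : g -> g -> g)
     (e : m.+2.-tuple g),
     (forall k, lambda k != 0) ->
     is_lie_bracket br -> basis_of fullv e -> diagonal_relations br e lambda ->
     forall (U : set 'rV[R[i]]_m.+2) (p q : 'I_m -> 'rV[R[i]]_m.+2 -> R[i]),
       domain U ->
       (forall j : 'I_m,
          power_branch U (ab_idx ord0) (- lambda (lift ord0 j)) (p j) /\
          power_branch U (ab_idx (lift ord0 j)) (lambda ord0) (q j)) ->
       basis_of_invariants br e U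
         (fun (j : 'I_m) (x : 'rV[R[i]]_m.+2) => p j x * q j x)).
Proof.
split=> lambda g br e lambda0 lie be rel U.
  move=> [oU _ _] Upos.
  have pos_branch (k : 'I_m.+1) (a : R) :
      log_branch expR U (ab_idx k) a (fun x => x 0 (ab_idx k) `^ a).
    exists (fun x => ln (x 0 (ab_idx k))) => [x Ux|x Ux].
      have ck : (fun y : 'rV[R]_m.+2 => y 0 (ab_idx k)) @ x --> x 0 (ab_idx k).
        exact: coord_continuous.
      exact: (cvg_comp _ _ ck (continuous_ln (Upos x Ux k))).
    (* Positivity of the coordinate rules out the special value of the real power at base 0, leaving
       [expR (a * ln _)]. *)
    by rewrite lnK ?posrE ?Upos// /powR gt_eqF ?Upos.
  exact: (basis_of_invariants_branches (exp_log_real R) lambda0 lie be rel oU).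
move=> p q [oU _ _] pq.
apply: (basis_of_invariants_branches (@exp_log_complex R) lambda0 lie be rel oU).
  by move=> j; have [] := pq j.
by move=> j; have [] := pq j.
Qed.
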